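(* Let $\Pi$ be a mini-gringo program and let $I$ be a set of precomputed atoms. Then $I$ is a stable model of $\Pi$ if and only if $I$ is a well-supported model of $\Pi$.
   Context: Mini-gringo syntax. Fix countably infinite sets of numerals, symbolic constants and program variables, and a bijection $n\mapsto\overline{n}$ from the integers to the numerals. Program terms are: numerals, symbolic constants, program variables, the symbols $\mathit{inf}$ and $\mathit{sup}$; $|t|$ for a term $t$; and $(t_1\circ t_2)$ for terms $t_1,t_2$ and $\circ\in\{+,-,\times,/,\backslash,..\}$. A term (or expression) without variables is ground; a ground term without operation symbols is precomputed. The precomputed terms are totally ordered so that $\mathit{inf}$ is least, $\mathit{sup}$ is greatest and $\overline{m}<\overline{n}$ iff $m<n$. An atom is $p(\mathbf{t})$ with $p$ a symbolic constant and $\mathbf{t}$ a tuple of terms; a literal is an atom preceded by zero, one or two occurrences of $\mathit{not}$; a comparison is $t_1\prec t_2$ with $\prec\in\{=,\neq,<,>,\le,\ge\}$. A rule is $\mathit{Head}\leftarrow\mathit{Body}$, where $\mathit{Body}$ is a possibly empty conjunction of literals and comparisons and $\mathit{Head}$ is an atom $p(\mathbf t)$ (basic rule), $\{p(\mathbf t)\}$ (choice rule) or empty (constraint). A program is a finite set of rules; each predicate symbol occurs with a single arity. For a rule $R$: $\mathrm{Body}(R)$ is its body, $B^+(R)$ is the set of atoms occurring un-negated in its body, and $\mathrm{HeadLit}(R)=p(\mathbf t)$ if the head is $p(\mathbf t)$ or $\{p(\mathbf t)\}$. An instance of a rule is obtained by replacing all its variables by precomputed terms. Values. For a ground term $t$,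 the set $\mathrm{vals}(t)$: $\{t\}$ if $t$ is a numeral, symbolic constant, $\mathit{inf}$ or $\mathit{sup}$; for $|t_1|$ the numerals $\overline{|n|}$ with $\overline n\in\mathrm{vals}(t_1)$; for $t_1\circ t_2$, $\circ\in\{+,-,\times\}$, the numerals $\overline{n_1\circ n_2}$ with $\overline{n_i}\in\mathrm{vals}(t_i)$; for $t_1/t_2$ the numerals $\overline{\mathrm{rd}(n_1/n_2)}$ and for $t_1\backslash t_2$ the numerals $\overline{n_1-n_2\cdot\mathrm{rd}(n_1/n_2)}$, with $\overline{n_i}\in\mathrm{vals}(t_i)$ and $n_2\ne0$, where $\mathrm{rd}(x)=\lfloor x\rfloor$ if $x\ge0$ and $\lceil x\rceil$ if $x<0$; for $t_1..t_2$ the numerals $\overline m$ with $n_1\le m\le n_2$ for some $\overline{n_i}\in\mathrm{vals}(t_i)$. For a tuple, $\mathrm{vals}(t_1,\dots,t_n)$ is the set of tuples $(r_1,\dots,r_n)$ with $r_i\in\mathrm{vals}(t_i)$. Translation $\tau$ (on ground expressions). $\tau(p(\mathbf t))=\bigvee_{\mathbf r\in\mathrm{vals}(\mathbf t)}p(\mathbf r)$, $\tau(\mathit{not}\,p(\mathbf t))=\bigvee_{\mathbf r}\neg p(\mathbf r)$, $\tau(\mathit{not}\,\mathit{not}\,p(\mathbf t))=\bigvee_{\mathbf r}\neg\neg p(\mathbf r)$; $\tau(t_1\prec t_2)$ is $\top$ if $r_1\prec r_2$ holds for some $r_i\in\mathrm{vals}(t_i)$ and $\bot$ otherwise; $\tau$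 of a conjunction is the conjunction of the $\tau$'s. For a ground basic rule $\tau(R)=\tau(\mathit{Body})\to\bigwedge_{\mathbf r\in\mathrm{vals}(\mathbf t)}p(\mathbf r)$; for a ground choice rule $\tau(R)=\tau(\mathit{Body})\to\bigwedge_{\mathbf r}(p(\mathbf r)\vee\neg p(\mathbf r))$; for a ground constraint $\tau(R)=\neg\tau(\mathit{Body})$. $\tau(\Pi)$ is the set of $\tau(R)$ for all instances $R$ of rules of $\Pi$. Stable models. Here $\neg F$ abbreviates $F\to\bot$. For a propositional formula $F$ and a set $I$ of precomputed atoms, the reduct $F^I$ is $\bot$ if $I\not\models F$; $p$ if $F$ is an atom $p$ with $I\models p$; and $G^I\otimes H^I$ if $F=G\otimes H$ with $\otimes\in\{\wedge,\vee,\to\}$ and $I\models F$. $\Gamma^I=\{F^I:F\in\Gamma\}$. $I$ is a stable model of a theory $\Gamma$ iff $I$ is the $\subseteq$-minimal model of $\Gamma^I$; $I$ is a stable model of a program $\Pi$ iff it is a stable model of $\tau(\Pi)$. Well-supported models. A strict well-founded partial order on $I$ is an irreflexive, transitive relation $\prec$ on $I$ with no infinite sequence $a_0,a_1,\dots$ such that $a_{i+1}\prec a_i$ for all $i$. $I$ is a well-supported interpretation of $\Pi$ iff there is a strict well-founded partial order $\prec$ on $I$ such that for every $p(\mathbf r)\in I$ there is an instance $R$ of a rule of $\Pi$ with: (1) $\mathrm{HeadLit}(R)=p(\mathbf t)$ and $\mathbf r\in\mathrm{vals}(\mathbf t)$; (2) $I\models\tau(\mathrm{Body}(R))$; (3)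 for every $q(\mathbf t')\in B^+(R)$ there is $\mathbf r'\in\mathrm{vals}(\mathbf t')$ with $q(\mathbf r')\in I$ and $q(\mathbf r')\prec p(\mathbf r)$. $I$ is a well-supported model of $\Pi$ iff it is a well-supported interpretation of $\Pi$ and $I\models\tau(\Pi)$. *)

(* Defs.v *)
From HB Require Import structures.
From mathcomp Require Import all_boot all_order all_algebra.
From mathcomp Require Import boolp classical_sets cardinality.
From Stdlib Require List.

Set Implicit Arguments.
Unset Strict Implicit.
Unset Printing Implicit Defensive.

Import Order.TTheory GRing.Theory Num.Theory.
Local Open Scope classical_set_scope.
Local Open Scope ring_scope.

(* Numerals are the image of the constructor Numeral, which is the bijection
   from the integers. *)
Inductive precomputed (S : Type) : Type :=
| Inf
| Numeral of int
| Symbol of S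
| Sup.
Arguments Inf {S}.
Arguments Numeral {S} _.
Arguments Sup {S}.

Definition precomputed_code (S : Type) (r : precomputed S) : bool + (int + S) :=
  match r with
  | Inf => inl false
  | Numeral n => inr (inl n)
  | Symbol s => inr (inr s)
  | Sup => inl true
  end.

Definition precomputed_decode (S : Type) (c : bool + (int + S)) :
    precomputed S :=
  match c with
  | inl b => if b then Sup else Inf
  | inr (inl n) => Numeral n
  | inr (inr s) => Symbol s
  end.

Lemma precomputed_codeK (S : Type) :
  cancel (@precomputed_code S) (@precomputed_decode S).
Proof. by case. Qed.

HB.instance Definition _ (S : countType) :=
  Countable.copy (precomputed S) (can_type (@precomputed_codeK S)).

Definition strict (T : eqType) (le : rel T) : rel T :=
  fun x y => (x != y) && le x y.

Record language : Type := Language {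
  symb : countType;
  var : countType;
  symb_infinite : infinite_set [set: symb];
  var_infinite : infinite_set [set: var];
  ple : rel (precomputed symb);
  ple_refl : reflexive ple;
  ple_anti : antisymmetric ple;
  ple_trans : transitive ple;
  ple_total : total ple;
  ple_inf : forall r, ple Inf r;
  ple_sup : forall r, ple r Sup;
  plt_numeral : forall m n : int,
    strict ple (Numeral m) (Numeral n) = (m < n)
}.

Definition pterm (L : language) : countType := precomputed (symb L).

Definition plt (L : language) : rel (pterm L) := strict (@ple L).

Inductive binop : Set := OAdd | OSub | OMul | ODiv | OMod | OInterval.

(* Expressions are indexed by their type V of variables: program expressions
   take V := var L, ground expressions take V := void. *)
Inductive term (L : language) (V : Type) : Type :=
| TPre of pterm L
| TVar of V
| TAbs of term L V
| TBin of binop & term L V & term L V.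
Arguments TPre {L V} _.

Record atom (L : language) (V : Type) : Type := Atom {
  pred_symb : symb L;
  args : seq (term L V)
}.

Inductive sign : Set := Pos | Not | NotNot.

Inductive cmp : Set := CEq | CNeq | CLt | CGt | CLe | CGe.

Inductive body_elt (L : language) (V : Type) : Type :=
| Literal of sign & atom L V
| Comparison of cmp & term L V & term L V.

Inductive head (L : language) (V : Type) : Type :=
| HBasic of atom L V
| HChoice of atom L V
| HConstraint.
Arguments HConstraint {L V}.

Record rule (L : language) (V : Type) : Type := Rule {
  rule_head : head L V;
  rule_body : seq (body_elt L V)
}.

Definition head_lit (L : language) (V : Type) (R : rule L V) :
    option (atom L V) :=
  match rule_head R with
  | HBasic a => Some a
  | HChoice a => Some a
  | HConstraint => None
  end.

Definition body_pos (L : language) (V : Type) (R : rule L V) :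
    set (atom L V) :=
  [set a | List.In (Literal Pos a) (rule_body R)].

Definition occurs_in (L : language) (V : Type) (a : atom L V) (R : rule L V) :
    Prop :=
  head_lit R = Some a \/ exists s, List.In (Literal s a) (rule_body R).

Record program (L : language) : Type := Program {
  rules : set (rule L (var L));
  rules_finite : finite_set rules;
  rules_single_arity : forall R R' a a', rules R -> rules R' ->
    occurs_in a R -> occurs_in a' R' -> pred_symb a = pred_symb a' ->
    size (args a) = size (args a')
}.

Section Instances.
Context (L : language) (V : Type) (sigma : V -> pterm L).

Fixpoint inst_term (t : term L V) : term L void :=
  match t with
  | TPre r => TPre r
  | TVar x => TPre (sigma x)
  | TAbs t1 => TAbs (inst_term t1)
  | TBin o t1 t2 => TBin o (inst_term t1) (inst_term t2)
  end.

Definition inst_atom (a : atom L V) : atom L void :=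
  Atom (pred_symb a) (map inst_term (args a)).

Definition inst_body_elt (b : body_elt L V) : body_elt L void :=
  match b with
  | Literal s a => Literal s (inst_atom a)
  | Comparison c t1 t2 => Comparison c (inst_term t1) (inst_term t2)
  end.

Definition inst_head (h : head L V) : head L void :=
  match h with
  | HBasic a => HBasic (inst_atom a)
  | HChoice a => HChoice (inst_atom a)
  | HConstraint => HConstraint
  end.

Definition inst_rule (R : rule L V) : rule L void :=
  Rule (inst_head (rule_head R)) (map inst_body_elt (rule_body R)).

End Instances.

Definition instances (L : language) (Pi : program L) : set (rule L void) :=
  [set R' | exists R sigma, rules Pi R /\ R' = inst_rule sigma R].

Definition rd (x : rat) : int := if 0 <= x then Num.floor x else Num.ceil x.

Definition int_range (m n : int) : seq int :=
  if m <= n then [seq m + k%:Z | k <- iota 0 `|n - m|%N.+1] else [::].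

Definition binop_vals (o : binop) (n1 n2 : int) : seq int :=
  match o with
  | OAdd => [:: n1 + n2]
  | OSub => [:: n1 - n2]
  | OMul => [:: n1 * n2]
  | ODiv => if n2 == 0 then [::] else [:: rd (n1%:Q / n2%:Q)]
  | OMod => if n2 == 0 then [::] else [:: n1 - n2 * rd (n1%:Q / n2%:Q)]
  | OInterval => int_range n1 n2
  end.

Definition numeral_value (S : Type) (r : precomputed S) : option int :=
  if r is Numeral n then Some n else None.

(* vals t is a finite set, given as a duplicate-free sequence. *)
Fixpoint vals (L : language) (t : term L void) : seq (pterm L) :=
  match t with
  | TPre r => [:: r]
  | TVar x => match x with end
  | TAbs t1 =>
      undup [seq Numeral `|n| | n <- pmap (@numeral_value _) (vals t1)]
  | TBin o t1 t2 =>
      undup [seq Numeral n |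
        n <- flatten [seq binop_vals o n1 n2 |
               n1 <- pmap (@numeral_value _) (vals t1),
               n2 <- pmap (@numeral_value _) (vals t2)]]
  end.

Fixpoint vals_tuple (L : language) (ts : seq (term L void)) :
    seq (seq (pterm L)) :=
  if ts is t :: ts' then [seq r :: rs | r <- vals t, rs <- vals_tuple ts']
  else [:: [::]].

Lemma mem_int_range (m n k : int) : (k \in int_range m n) = (m <= k <= n).
Proof.
rewrite /int_range; case: ifPn => [lemn|]; last first.
  rewrite -ltNge => ltnm; rewrite in_nil; apply/esym/negP => /andP[mk kn].
  by have := le_lt_trans (le_trans mk kn) ltnm; rewrite ltxx.
have Edist : (`|n - m|%N)%:Z = n - m by rewrite gez0_abs // subr_ge0.
apply/mapP/idP => [[i]|/andP[mk kn]].
  rewrite mem_iota add0n ltnS => /andP[_ lti] ->.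
  by rewrite lerDl /= -lerBrDl -Edist lez_nat.
have Ek : (`|k - m|%N)%:Z = k - m by rewrite gez0_abs // subr_ge0.
exists `|k - m|%N; last by rewrite Ek addrC subrK.
by rewrite mem_iota /= add0n ltnS -lez_nat Ek Edist lerD2r.
Qed.

Lemma mem_numeral_values (S : countType) (s : seq (precomputed S)) (n : int) :
  (n \in pmap (@numeral_value S) s) = (Numeral n \in s).
Proof.
elim: s => //= -[|m|c|] s IHs /=; rewrite !inE ?IHs //.
Qed.

Lemma mem_vals_abs (L : language) (t : term L void) (r : pterm L) :
  r \in vals (TAbs t) <->
  exists2 n : int, Numeral n \in vals t & r = Numeral `|n|.
Proof.
rewrite /= mem_undup; split=> [/mapP[n]|[n tn ->]].
  by rewrite mem_numeral_values => tn ->; exists n.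
by apply/mapP; exists n; rewrite ?mem_numeral_values.
Qed.

Lemma mem_vals_bin (L : language) (o : binop) (t1 t2 : term L void)
    (r : pterm L) :
  r \in vals (TBin o t1 t2) <->
  exists n1 n2 n : int, [/\ Numeral n1 \in vals t1, Numeral n2 \in vals t2,
    n \in binop_vals o n1 n2 & r = Numeral n].
Proof.
rewrite /= mem_undup; split=> [/mapP[n /flattenP[s /allpairsP[[n1 n2] /=]]]|].
  by rewrite !mem_numeral_values => -[t1n t2n ->] on ->; exists n1, n2, n.
move=> [n1] [n2] [n] [t1n t2n on ->]; apply/map_f/flattenP.
exists (binop_vals o n1 n2) => //; apply/allpairsP; exists (n1, n2).
by rewrite !mem_numeral_values.
Qed.

Lemma vals_uniq (L : language) (t : term L void) : uniq (vals t).
Proof. by case: t => [r|[]|t|o t1 t2] //=; rewrite undup_uniq. Qed.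

Lemma mem_vals_tuple (L : language) (ts : seq (term L void))
    (rs : seq (pterm L)) :
  (rs \in vals_tuple ts) = all2 (fun r t => r \in vals t) rs ts.
Proof.
elim: ts rs => [|t ts IHts] [|r rs] //=.
  by apply/negP => /allpairsP[[? ?] []].
rewrite -IHts; apply/allpairsP/andP => [[[r' rs'] /= [tr tsrs [-> ->]]]|[tr tsrs]].
  by [].
by exists (r, rs).
Qed.

Lemma vals_tuple_uniq (L : language) (ts : seq (term L void)) :
  uniq (vals_tuple ts).
Proof.
elim: ts => //= t ts IHts; apply: allpairs_uniq => //; first exact: vals_uniq.
by move=> [r rs] [r' rs'] _ _ /= [-> ->].
Qed.

Definition patom (L : language) : Type := (symb L * seq (pterm L))%type.

Inductive formula (A : Type) : Type :=
| FBot
| FAtom of A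
| FAnd of formula A & formula A
| FOr of formula A & formula A
| FImp of formula A & formula A.
Arguments FBot {A}.

Definition FNot (A : Type) (F : formula A) : formula A := FImp F FBot.
Definition FTop {A : Type} : formula A := FImp FBot FBot.

Fixpoint bigFAnd (A : Type) (s : seq (formula A)) : formula A :=
  match s with
  | [::] => FTop
  | [:: F] => F
  | F :: s' => FAnd F (bigFAnd s')
  end.

Fixpoint bigFOr (A : Type) (s : seq (formula A)) : formula A :=
  match s with
  | [::] => FBot
  | [:: F] => F
  | F :: s' => FOr F (bigFOr s')
  end.

Fixpoint sat (A : Type) (I : set A) (F : formula A) : Prop :=
  match F with
  | FBot => False
  | FAtom a => I a
  | FAnd G H => sat I G /\ sat I H
  | FOr G H => sat I G \/ sat I H
  | FImp G H => sat I G -> sat I H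
  end.

Definition model (A : Type) (I : set A) (Gamma : set (formula A)) : Prop :=
  forall F, Gamma F -> sat I F.

Fixpoint reduct (A : Type) (I : set A) (F : formula A) : formula A :=
  if `[< sat I F >] then
    match F with
    | FBot => FBot
    | FAtom a => FAtom a
    | FAnd G H => FAnd (reduct I G) (reduct I H)
    | FOr G H => FOr (reduct I G) (reduct I H)
    | FImp G H => FImp (reduct I G) (reduct I H)
    end
  else FBot.

Definition stable (A : Type) (Gamma : set (formula A)) (I : set A) : Prop :=
  let Gamma_I := [set reduct I F | F in Gamma] in
  model I Gamma_I /\ forall J, J `<=` I -> model J Gamma_I -> J = I.

Definition eval_cmp (L : language) (c : cmp) (r1 r2 : pterm L) : bool :=
  match c with
  | CEq => r1 == r2
  | CNeq => r1 != r2
  | CLt => plt r1 r2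
  | CGt => plt r2 r1
  | CLe => ple r1 r2
  | CGe => ple r2 r1
  end.

Definition signed (A : Type) (s : sign) (F : formula A) : formula A :=
  match s with
  | Pos => F
  | Not => FNot F
  | NotNot => FNot (FNot F)
  end.

(* The precomputed atoms p(r) for r in vals(t), where a is p(t). *)
Definition atom_vals (L : language) (a : atom L void) : seq (patom L) :=
  [seq (pred_symb a, r) | r <- vals_tuple (args a)].

Definition tau_body_elt (L : language) (b : body_elt L void) :
    formula (patom L) :=
  match b with
  | Literal s a => bigFOr [seq signed s (FAtom x) | x <- atom_vals a]
  | Comparison c t1 t2 =>
      if has (fun r1 => has (eval_cmp c r1) (vals t2)) (vals t1) then FTop
      else FBot
  end.

Definition tau_body (L : language) (B : seq (body_elt L void)) :
    formula (patom L) :=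
  bigFAnd (map (@tau_body_elt L) B).

Definition tau_rule (L : language) (R : rule L void) : formula (patom L) :=
  let B := tau_body (rule_body R) in
  match rule_head R with
  | HBasic a => FImp B (bigFAnd [seq FAtom x | x <- atom_vals a])
  | HChoice a =>
      FImp B (bigFAnd [seq FOr (FAtom x) (FNot (FAtom x)) | x <- atom_vals a])
  | HConstraint => FNot B
  end.

Definition tau (L : language) (Pi : program L) : set (formula (patom L)) :=
  [set tau_rule R | R in instances Pi].

Definition stable_model (L : language) (Pi : program L) (I : set (patom L)) :
    Prop :=
  stable (tau Pi) I.

Record strict_wf_order_on (A : Type) (I : set A) (lt : A -> A -> Prop) :
    Prop := {
  swo_on : forall a b, lt a b -> I a /\ I b;
  swo_irrefl : forall a, ~ lt a a;
  swo_trans : forall a b c, lt a b -> lt b c -> lt a c;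
  swo_wf : ~ exists u : nat -> A, forall i, lt (u i.+1) (u i)
}.

Definition well_supported (L : language) (Pi : program L)
    (I : set (patom L)) : Prop :=
  exists2 lt : patom L -> patom L -> Prop, strict_wf_order_on I lt &
    forall (p : symb L) (r : seq (pterm L)), I (p, r) ->
      exists2 R, instances Pi R &
        [/\ exists2 t, head_lit R = Some (Atom p t) & r \in vals_tuple t,
            sat I (tau_body (rule_body R))
          & forall (q : symb L) (t' : seq (term L void)),
              body_pos R (Atom q t') ->
              exists r', [/\ r' \in vals_tuple t', I (q, r')
                           & lt (q, r') (p, r)]].

Definition well_supported_model (L : language) (Pi : program L)
    (I : set (patom L)) : Prop :=
  well_supported Pi I /\ model I (tau Pi).

(* Main.v *)
Require Import Defs.
From mathcomp Require Import all_boot all_order all_algebra.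
From mathcomp Require Import boolp classical_sets cardinality.
From Stdlib Require List.

(** Let [I] satisfy a ground rule. A subset [J] of [I] satisfies the reduct of
    the rule iff, whenever [I] satisfies the body and every positive body atom
    has a value in [J], all values of the head that lie in [I] lie in [J].

    If [I] is stable, iterate the induced immediate-consequence operator inside
    [I], starting from the empty set. As rule bodies are finite, the union of
    the stages is a model of the reduct, hence all of [I]; ordering the atoms
    by the first stage at which they appear shows that [I] is well-supported.

    Conversely, if [J] is a proper subset of a well-supported [I] and satisfies
    the reduct, then every atom of [I] outside [J] has, in its supporting rule,
    a positive body atom that is smaller and also outside [J], which yields an
    infinite descending sequence. *)

Set Implicit Arguments.
Unset Strict Implicit.
Unset Printing Implicit Defensive.

Local Open Scope classical_set_scope.

Lemma InP (T : eqType) (x : T) (s : seq T) : reflect (List.In x s) (x \in s).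
Proof.
apply: (iffP idP); elim: s => //= y s IHs.
  by rewrite inE => /predU1P[->|/IHs]; [left|right].
by rewrite inE => -[->|/IHs ->]; rewrite ?eqxx ?orbT.
Qed.

(** * Satisfaction of reducts, one connective at a time *)

Section SatReduct.
Context (A : Type) (J I : set A).
Implicit Types (F G H : formula A) (s : seq (formula A)).

(** If [I] falsifies [F], the reduct is [FBot], which no [J] satisfies. *)
Lemma sat_of_reduct F : sat J (reduct I F) -> sat I F.
Proof. by case: F => [|a|G H|G H|G H] /=; case: ifPn => // /asboolP. Qed.

Lemma sat_reduct_atom a : sat J (reduct I (FAtom a)) <-> I a /\ J a.
Proof. by rewrite /=; case: asboolP => ? /=; tauto. Qed.

Lemma sat_reduct_and G H :
  sat J (reduct I (FAnd G H)) <-> sat J (reduct I G) /\ sat J (reduct I H).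
Proof.
split=> [|[JG JH]] /=; first by case: asboolP.
by rewrite asboolT //; split; exact: sat_of_reduct.
Qed.

Lemma sat_reduct_or G H :
  sat J (reduct I (FOr G H)) <-> sat J (reduct I G) \/ sat J (reduct I H).
Proof.
split=> [|JGH] /=; first by case: asboolP.
by rewrite asboolT //; case: JGH => /sat_of_reduct; [left|right].
Qed.

Lemma sat_reduct_imp G H :
  sat J (reduct I (FImp G H)) <->
  (sat I G -> sat I H) /\ (sat J (reduct I G) -> sat J (reduct I H)).
Proof. by rewrite /=; case: asboolP => ? /=; tauto. Qed.

(** When [F] fails in [I], its reduct is [FBot], so the reduct of the negation is a tautology: [J]
    has no influence. *)
Lemma sat_reduct_not F : sat J (reduct I (FNot F)) <-> ~ sat I F.
Proof.
rewrite sat_reduct_imp; split=> [[]//|nF].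
by split=> // /sat_of_reduct.
Qed.

Lemma sat_reduct_bigFAnd s :
  sat J (reduct I (bigFAnd s)) <->
  forall F, List.In F s -> sat J (reduct I F).
Proof.
elim: s => [|F [|G s] IHs].
- by split=> // _; rewrite sat_reduct_imp.
- by split=> [JF H [<-|[]]//|]; apply; left.
rewrite sat_reduct_and IHs; split=> [[JF Js] H [<-//|/Js//]|Js].
by split=> [|H sH]; apply: Js; [left|right].
Qed.

Lemma sat_reduct_bigFOr s :
  sat J (reduct I (bigFOr s)) <->
  exists2 F, List.In F s & sat J (reduct I F).
Proof.
elim: s => [|F [|G s] IHs].
- by rewrite /= if_same; split=> [|[]].
- by split=> [JF|[H [->|[]]]//]; exists F => //; left.
rewrite sat_reduct_or IHs; split=> [[JF|[H sH JH]]|[H [<-|sH] JH]].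
- by exists F => //; left.
- by exists H => //; right.
- by left.
- by right; exists H.
Qed.

Lemma sat_reduct_bigFAnd_map (T : eqType) (f : T -> formula A) (r : seq T) :
  sat J (reduct I (bigFAnd [seq f x | x <- r])) <->
  forall x, x \in r -> sat J (reduct I (f x)).
Proof.
rewrite sat_reduct_bigFAnd; split=> [Jr x /InP rx|Jr F /List.in_map_iff[x]].
  by apply: Jr; exact: List.in_map.
by move=> [<- /InP]; exact: Jr.
Qed.

Lemma sat_reduct_bigFOr_map (T : eqType) (f : T -> formula A) (r : seq T) :
  sat J (reduct I (bigFOr [seq f x | x <- r])) <->
  exists2 x, x \in r & sat J (reduct I (f x)).
Proof.
rewrite sat_reduct_bigFOr; split=> [[F /List.in_map_iff[x [<- /InP rx]] Jx]|].
  by exists x.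
by move=> [x /InP rx Jx]; exists (f x) => //; exact: List.in_map.
Qed.

End SatReduct.

Lemma sat_reduct_diag (A : Type) (I : set A) (F : formula A) :
  sat I (reduct I F) <-> sat I F.
Proof.
split=> [/sat_of_reduct//|].
elim: F => [//|a|G IHG H IHH|G IHG H IHH|G IHG H IHH].
- by move=> Ia; apply/sat_reduct_atom.
- by move=> [/IHG IG /IHH IH]; apply/sat_reduct_and.
- by move=> IGH; apply/sat_reduct_or; case: IGH => [/IHG|/IHH]; [left|right].
- by move=> IGH; apply/sat_reduct_imp; split=> // /sat_of_reduct /IGH /IHH.
Qed.

Lemma exists_descending (A : Type) (lt : A -> A -> Prop) (P : set A) (a : A) :
  P a -> (forall x, P x -> exists2 y, P y & lt y x) ->
  exists u : nat -> A, forall i, lt (u i.+1) (u i).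
Proof.
move=> Pa Plt.
(* Choice needs a total function: outside [P] the value is arbitrary, here [x] itself. *)
have /choice[f Pf] : forall x, exists y, P x -> P y /\ lt y x.
  move=> x; have [/Plt[y Py ltyx]|nPx] := pselect (P x); first by exists y.
  by exists x.
have Pu i : P (iter i f a) by elim: i => //= i /Pf[].
by exists (fun i => iter i f a) => i; have [] := Pf _ (Pu i).
Qed.

(** * Reducts of ground bodies and rules *)

Section Rules.
Context (L : language).
Implicit Types (I J : set (patom L)) (R : rule L void) (x : patom L).

Lemma mem_atom_vals (p q : symb L) (t : seq (term L void))
    (r : seq (pterm L)) :
  ((p, r) \in atom_vals (Atom q t)) = (p == q) && (r \in vals_tuple t).
Proof.
apply/mapP/andP => [[r' tr [-> ->]]|[/eqP-> tr]]; last by exists r.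
by rewrite eqxx.
Qed.

Lemma sat_reduct_pos_literal J I (a : atom L void) :
  sat J (reduct I (tau_body_elt (Literal Pos a))) <->
  exists2 x, x \in atom_vals a & I x /\ J x.
Proof.
by rewrite sat_reduct_bigFOr_map; split=> -[x ax /sat_reduct_atom]; exists x.
Qed.

(** What holds in [I] here rests on a negation or [FTop], whose reduct is then a tautology. Only
    un-negated literals can constrain [J]. *)
Lemma sat_reduct_nonpos J I (b : body_elt L void) :
  (forall a, b <> Literal Pos a) ->
  sat I (tau_body_elt b) -> sat J (reduct I (tau_body_elt b)).
Proof.
case: b => [[] a|c t1 t2] /= nonpos.
- by have := nonpos a.
- move=> /sat_reduct_diag/sat_reduct_bigFOr_map[x ax /sat_of_reduct Ix].
  by apply/sat_reduct_bigFOr_map; exists x => //; apply/sat_reduct_not.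
- move=> /sat_reduct_diag/sat_reduct_bigFOr_map[x ax /sat_of_reduct Ix].
  by apply/sat_reduct_bigFOr_map; exists x => //; apply/sat_reduct_not.
- by case: ifP => // _ _; apply/sat_reduct_not.
Qed.

Lemma sat_reduct_tau_body J I R :
  sat J (reduct I (tau_body (rule_body R))) <->
  sat I (tau_body (rule_body R)) /\
  forall a, body_pos R a -> exists2 x, x \in atom_vals a & I x /\ J x.
Proof.
split=> [JB|[/sat_reduct_diag/sat_reduct_bigFAnd IB posB]].
  split=> [|a Ra]; first exact: sat_of_reduct JB.
  apply/sat_reduct_pos_literal; move/sat_reduct_bigFAnd: JB; apply.
  exact: List.in_map Ra.
apply/sat_reduct_bigFAnd => F BF.
have /sat_of_reduct := IB _ BF.
case/List.in_map_iff: BF => b [<- Bb] Ib.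
have [[a ba]|nonpos] := pselect (exists a, b = Literal Pos a).
  by move: Bb; rewrite ba => /posB /sat_reduct_pos_literal.
by apply: sat_reduct_nonpos Ib => a ba; apply: nonpos; exists a.
Qed.

(** The restriction to [I x] treats both kinds of heads alike: once the body holds, [I] contains all
    values of a basic head, while in a choice head the values outside [I] are covered by the negated
    disjunct. *)
Lemma sat_reduct_tau_rule J I R :
  sat J (reduct I (tau_rule R)) <->
  sat I (tau_rule R) /\
  (sat J (reduct I (tau_body (rule_body R))) ->
   forall a, head_lit R = Some a ->
   forall x, x \in atom_vals a -> I x -> J x).
Proof.
rewrite /tau_rule /head_lit; case: (rule_head R) => [a|a|].
- rewrite sat_reduct_imp; split=> -[IR JR]; split=> //.
    move=> /JR/sat_reduct_bigFAnd_map JH _ [<-] x /JH.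
    by case/sat_reduct_atom.
  move=> JB; apply/sat_reduct_bigFAnd_map => x ax.
  move/sat_of_reduct: (JB) => /IR/sat_reduct_diag/sat_reduct_bigFAnd_map IH.
  have /sat_reduct_atom[Ix _] := IH x ax.
  by apply/sat_reduct_atom; split=> //; exact: (JR JB a).
- rewrite sat_reduct_imp; split=> -[IR JR]; split=> //.
    move=> /JR/sat_reduct_bigFAnd_map JH _ [<-] x /JH /sat_reduct_or[].
      by case/sat_reduct_atom.
    by move/sat_reduct_not.
  move=> JB; apply/sat_reduct_bigFAnd_map => x ax.
  apply/sat_reduct_or; have [Ix|nIx] := pselect (I x); [left|right].
    by apply/sat_reduct_atom; split=> //; exact: (JR JB a).
  exact/sat_reduct_not.
- by rewrite sat_reduct_not; split=> [|[]].
Qed.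

(** * Support by rules; from well-supported to stable *)

Context (Pi : program L).

Lemma model_reduct_tauP J I :
  model J [set reduct I F | F in tau Pi] <->
  forall R, instances Pi R -> sat J (reduct I (tau_rule R)).
Proof.
split=> [JPi R PiR|JPi _ [_ [R PiR <-] <-]]; last exact: JPi.
by apply: JPi; exists (tau_rule R) => //; exists R.
Qed.

Lemma model_reduct_diag I :
  model I [set reduct I F | F in tau Pi] <-> model I (tau Pi).
Proof.
rewrite model_reduct_tauP; split=> [IPi _ [R PiR <-]|IPi R PiR].
  by apply/sat_reduct_diag/IPi.
by apply/sat_reduct_diag/IPi; exists R.
Qed.

(** [I] evaluates the whole body and [J] supplies only its un-negated atoms, so support is monotone
    in [J]. For [J] one takes the predecessors of [x], or a stage of the iteration. *)
Definition supports I J R x : Prop :=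
  [/\ exists2 a, head_lit R = Some a & x \in atom_vals a,
      sat I (tau_body (rule_body R))
    & forall b, body_pos R b -> exists2 y, y \in atom_vals b & J y].

Lemma supports_mono I J J' R x :
  J `<=` J' -> supports I J R x -> supports I J' R x.
Proof.
move=> JJ' [hd IB posB]; split=> // b /posB[y ay Jy].
by exists y => //; exact: JJ'.
Qed.

(** As [J] lies in [I], the supporting values in [J] make the reduct of the body true in [J], and
    the rule carries this over to the head. *)
Lemma supports_closed J I R x : J `<=` I -> sat J (reduct I (tau_rule R)) ->
  supports I J R x -> I x -> J x.
Proof.
move=> JI /sat_reduct_tau_rule[_ JR] [[a Ra ax] IB posB] Ix.
apply: JR ax Ix => //; apply/sat_reduct_tau_body; split=> // b /posB[y yb Jy].
by exists y => //; split=> //; exact: JI.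
Qed.

Lemma well_supportedP I :
  well_supported Pi I <->
  exists2 lt : patom L -> patom L -> Prop, strict_wf_order_on I lt &
    forall x, I x ->
      exists2 R, instances Pi R & supports I [set y | I y /\ lt y x] R x.
Proof.
split=> -[lt swo ws]; exists lt => //.
  move=> [p r] /ws[R PiR [[t Rt tr] IB posB]]; exists R => //; split=> //.
    by exists (Atom p t) => //; rewrite mem_atom_vals eqxx.
  move=> [q t'] /posB[r' [t'r' Iy ltyx]]; exists (q, r') => //.
  by rewrite mem_atom_vals eqxx.
move=> p r /ws[R PiR [[[p' t] Rt]]].
rewrite mem_atom_vals => /andP[/eqP pp' tr] IB posB; exists R => //.
split=> //; first by exists t; rewrite ?pp'.
move=> q t' /posB[[q' r']]; rewrite mem_atom_vals => /andP[/eqP-> t'r'] [Iy].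
by exists r'.
Qed.

Lemma well_supported_stable I :
  well_supported_model Pi I -> stable_model Pi I.
Proof.
move=> [/well_supportedP[lt swo ws] IPi]; split; first exact/model_reduct_diag.
move=> J JI /model_reduct_tauP JPi; apply/seteqP; split=> // x Ix.
apply: contrapT => nJx; apply: (swo_wf swo).
apply: (@exists_descending _ _ (I `\` J) x) => // {Ix nJx}x [Ix nJx].
apply: contrapT => nex; apply: nJx.
have [R PiR Rx] := ws x Ix.
apply: (supports_closed JI (JPi R PiR)) => //.
apply: supports_mono Rx => y [Iy ltyx].
by apply: contrapT => nJy; apply: nex; exists y.
Qed.

(** * Stages of the consequence operator; from stable to well-supported *)

(** The conjunct [I x] keeps the iteration inside [I], since a choice rule may support atoms outside
    it. *)
Fixpoint stage I (n : nat) : set (patom L) :=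
  if n is m.+1 then
    [set x | I x /\ exists2 R, instances Pi R & supports I (stage I m) R x]
  else set0.

Lemma stage_sub I n : stage I n `<=` I.
Proof. by case: n => //= n x []. Qed.

Lemma stage_mono I m n : (m <= n)%N -> stage I m `<=` stage I n.
Proof.
elim: m n => [n _ x []|m IHm [//|n] lemn x /= [Ix [R PiR Rx]]].
by split=> //; exists R => //; apply: supports_mono Rx; exact: IHm.
Qed.

Lemma exists_last_out_stage I n x :
  stage I n x -> exists m, stage I m.+1 x /\ ~ stage I m x.
Proof.
elim: n => // n IHn Sx; have [/IHn//|nSx] := pselect (stage I n x).
by exists n.
Qed.

Lemma supports_bigcup_stage I R x :
  supports I (\bigcup_n stage I n) R x -> exists n, supports I (stage I n) R x.
Proof.
move=> [hd IB posB].
suff [n Sn] : exists n, forall b, List.In (Literal Pos b) (rule_body R) ->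
    exists2 y, y \in atom_vals b & stage I n y by exists n; split.
move: posB; rewrite /body_pos /=; elim: (rule_body R) => [|c B IHB] posB.
  by exists 0%N.
have [n Sn] : exists n, forall b, List.In (Literal Pos b) B ->
    exists2 y, y \in atom_vals b & stage I n y.
  by apply: IHB => b Bb; apply: posB; right.
have [[a ca]|nonpos] := pselect (exists a, c = Literal Pos a).
  have [|y ay [m _ Sy]] := posB a; first by left.
  (* The stages increase, so the larger index serves both the first body element and the rest. *)
  exists (maxn m n) => b [|/Sn[z bz Sz]].
    rewrite ca => -[<-]; exists y => //.
    by apply: stage_mono Sy; exact: leq_maxl.
  by exists z => //; apply: stage_mono Sz; exact: leq_maxr.
by exists n => b [cb|/Sn//]; case: nonpos; exists b.
Qed.

(** [x] enters strictly before [y]: a separating stage replaces the comparison of ranks. *)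
Definition stage_lt I x y : Prop :=
  I y /\ exists2 n, stage I n x & ~ stage I n y.

Lemma stage_ltn I m n x : stage I m x -> ~ stage I n x -> (n < m)%N.
Proof.
move=> Sx nSx; rewrite ltnNge; apply/negP => lemn.
by apply: nSx; exact: stage_mono Sx.
Qed.

Lemma stage_lt_swo I :
  I `<=` \bigcup_n stage I n -> strict_wf_order_on I (stage_lt I).
Proof.
move=> IS; split.
- by move=> a b [Ib [n /stage_sub]].
- by move=> a [_ [n]].
- move=> a b c [Ib [n Sa nSb]] [Ic [m Sb nSc]]; split=> //; exists m => //.
  exact: stage_mono (ltnW (stage_ltn Sb nSb)) _ Sa.
- move=> [u ltu].
  (* If [u i] were in stage [n.+1], the separating stage would be at most [n] and would contain
     [u i.+1]. *)
  have nS n i : ~ stage I n (u i).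
    elim: n i => [i []|n IHn i Su]; have [_ [m Su1 nSu]] := ltu i.
    by apply: (IHn i.+1); apply: stage_mono Su1; exact: stage_ltn Su nSu.
  have [Iu _] := ltu 0%N.
  by have [n _ /nS] := IS _ Iu.
Qed.

Lemma stable_well_supported I :
  stable_model Pi I -> well_supported_model Pi I.
Proof.
move=> [/model_reduct_diag IPi minI]; split=> //.
have IS : I `<=` \bigcup_n stage I n.
  (* By minimality of [I] it suffices that the union is a model of the reduct. *)
  suff -> : \bigcup_n stage I n = I by [].
  apply: minI => [x [n _ /stage_sub]//|]; apply/model_reduct_tauP => R PiR.
  apply/sat_reduct_tau_rule; split=> [|/sat_reduct_tau_body[IB posB] a Ra x ax].
    by apply: IPi; exists R.
  move=> Ix; have [|n Rx] := @supports_bigcup_stage I R x.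
    by split=> // [|b /posB[y by_ []]]; [exists a|exists y].
  by exists n.+1 => //; split=> //; exists R.
apply/well_supportedP; exists (stage_lt I); first exact: stage_lt_swo.
(* [x] enters at stage [m.+1], so its support lies in stage [m], which separates it from [x]. *)
move=> x /IS[k _ /exists_last_out_stage[m [[Ix [R PiR Rx]] nSx]]].
exists R => //; apply: supports_mono Rx => y Sy.
by split; [exact: stage_sub Sy|split=> //; exists m].
Qed.

End Rules.

Theorem mainTheorem1 (L : language) (Pi : program L) (I : set (patom L)) :
  stable_model Pi I <-> well_supported_model Pi I.
Proof.
by split; [exact: stable_well_supported|exact: well_supported_stable].
Qed.
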